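(* Let $X$ be a topological space in which every open set is a union of countably many clopen sets. The following are equivalent: (1) for every Borel function $\Psi:X\to\mathbb{N}^{\mathbb{N}}$, $\Psi[X]$ is a bounded subset of $\mathbb{N}^{\mathbb{N}}$; (2) for every continuous function $\Psi:X\to\overline{\mathbb{N}}^{\mathbb{N}}$, $\Psi[X]$ is a bounded subset of $\overline{\mathbb{N}}^{\mathbb{N}}$.
   Context: $\overline{\mathbb{N}}=\mathbb{N}\cup\{\infty\}$ is the one-point compactification of $\mathbb{N}$, and $\overline{\mathbb{N}}^{\mathbb{N}}$ has the product topology. A set $Y\subseteq\overline{\mathbb{N}}^{\mathbb{N}}$ is bounded if there is $g\in\mathbb{N}^{\mathbb{N}}$ such that for each $f\in Y$ and all but finitely many $n$, $f(n)<\infty$ implies $f(n)\le g(n)$. (For $Y\subseteq\mathbb{N}^{\mathbb{N}}$ this is the usual notion: each $f\in Y$ satisfies $f(n)\le g(n)$ for all but finitely many $n$.) *)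

(* Defs.v *)
From Stdlib Require Import Arith.

Record Topology (X : Type) := {
  isOpen : (X -> Prop) -> Prop;
  open_ext : forall U V, (forall x, U x <-> V x) -> isOpen U -> isOpen V;
  open_full : isOpen (fun _ => True);
  open_inter : forall U V, isOpen U -> isOpen V -> isOpen (fun x => U x /\ V x);
  open_union : forall F : (X -> Prop) -> Prop,
      (forall U, F U -> isOpen U) -> isOpen (fun x => exists U, F U /\ U x)
}.
Arguments isOpen {X} t U.

Definition clopen {X : Type} (T : Topology X) (C : X -> Prop) : Prop :=
  isOpen T C /\ isOpen T (fun x => ~ C x).

(* Every open set is a union of countably many clopen sets
   (a countable family is indexed by nat; finite/empty families by repetition,
   the empty set being clopen). *)
Definition open_countable_union_clopen {X : Type} (T : Topology X) : Prop :=
  forall U, isOpen T U ->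
    exists C : nat -> X -> Prop,
      (forall n, clopen T (C n)) /\ (forall x, U x <-> exists n, C n x).

Inductive borel {X : Type} (T : Topology X) : (X -> Prop) -> Prop :=
| borel_open : forall U, isOpen T U -> borel T U
| borel_compl : forall A, borel T A -> borel T (fun x => ~ A x)
| borel_cunion : forall A : nat -> X -> Prop,
    (forall n, borel T (A n)) -> borel T (fun x => exists n, A n x)
| borel_ext : forall A B, (forall x, A x <-> B x) -> borel T A -> borel T B.

Definition prod_open {Y : Type} (opY : (Y -> Prop) -> Prop)
    (U : (nat -> Y) -> Prop) : Prop :=
  forall f, U f ->
    exists (n : nat) (V : nat -> Y -> Prop),
      (forall i, i < n -> opY (V i)) /\
      (forall i, i < n -> V i (f i)) /\
      (forall g, (forall i, i < n -> V i (g i)) -> U g).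

Definition nat_open (V : nat -> Prop) : Prop := True.

(* Nbar = N ∪ {∞} represented as option nat (None = ∞), one-point
   compactification of discrete N: V is open iff ∞ ∈ V implies V is cofinite
   (contains a tail of N). *)
Definition nbar := option nat.
Definition nbar_open (V : nbar -> Prop) : Prop :=
  V None -> exists m, forall k, m <= k -> V (Some k).

Definition baire_open := prod_open nat_open.
Definition nbarN_open := prod_open nbar_open.

Definition borel_fun {X : Type} (T : Topology X) (Psi : X -> nat -> nat) : Prop :=
  forall U, baire_open U -> borel T (fun x => U (Psi x)).

Definition continuous_nbarN {X : Type} (T : Topology X) (Psi : X -> nat -> nbar) : Prop :=
  forall U, nbarN_open U -> isOpen T (fun x => U (Psi x)).

Definition bounded_N (Y : (nat -> nat) -> Prop) : Prop :=
  exists g : nat -> nat, forall f, Y f ->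
    exists N, forall n, N <= n -> f n <= g n.

Definition bounded_nbar (Y : (nat -> nbar) -> Prop) : Prop :=
  exists g : nat -> nat, forall f, Y f ->
    exists N, forall n, N <= n -> forall k, f n = Some k -> k <= g n.

Definition image {X Y : Type} (Psi : X -> Y) : Y -> Prop :=
  fun y => exists x, Psi x = y.

(* Main.v *)
Require Import Defs.
From Stdlib Require Import Arith Lia Classical IndefiniteDescription Cantor.

(** Given clopen sets [C n k], the map sending [x] to the sequence of the least
    [k] with [x] in [C n k] (infinity if there is none) is continuous into
    Nbar^N.  Thus (2) bounds these least indices, for almost all [n], by a single
    [g n].  Writing open sets [U n] as unions of clopen sets, one gets clopen
    [D n] inside [U n] such that each point of [U n] lies in [D n] for almost all
    [n].  It follows that every G_delta set is F_sigma, so that every Borel set is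
    F_sigma.  For a Borel map [Psi], cover X for each [n] by countably many closed
    sets [F n k] on each of which [Psi _ n] is constant, and choose clopen
    [E n k] containing [F n k] with equality at each point for almost all pairs
    [(n, k)].  The least [k] with [x] in [E n k] is bounded, again by (2), hence
    so is the value of [Psi x n].  Conversely, replacing infinity by 0 turns a
    continuous map into Nbar^N into a Borel map into N^N. *)

Section Topology.
Context {X : Type} (T : Topology X).

(** * Open and clopen sets *)

Lemma open_indexed_union {I : Type} (P : I -> Prop) (A : I -> X -> Prop) :
  (forall i, P i -> isOpen T (A i)) -> isOpen T (fun x => exists i, P i /\ A i x).
Proof.
  intros HA.
  (* Sets need not be equal when they have the same points, so the family consists of all [U]
     pointwise equivalent to some [A i]. *)
  apply open_ext with
    (U := fun x => exists U, (exists i, P i /\ forall y, U y <-> A i y) /\ U x).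
  - intro x; split.
    + intros [U [[i [Hi HU]] Ux]]. exists i. split; [exact Hi | now apply HU].
    + intros [i [Hi Ax]]. exists (A i). split; [| exact Ax].
      exists i. split; [exact Hi | reflexivity].
  - apply open_union. intros U [i [Hi HU]].
    apply open_ext with (U := A i); [| now apply HA].
    intro x. symmetry. apply HU.
Qed.

Lemma open_const (P : Prop) : isOpen T (fun _ => P).
Proof.
  apply open_ext with (U := fun x => exists u : unit, P /\ True).
  - intro x. split; [now intros [_ [HP _]] | intro HP; now exists tt].
  - apply open_indexed_union with (P := fun _ => P). intros _ _. apply open_full.
Qed.

Lemma open_locally (A : X -> Prop) :
  (forall x, A x -> exists U, isOpen T U /\ U x /\ forall y, U y -> A y) ->
  isOpen T A.
Proof.
  intro H.
  apply open_ext with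
    (U := fun x => exists U : X -> Prop, (isOpen T U /\ forall y, U y -> A y) /\ U x).
  - intro x. split.
    + intros [U [[_ HU] Ux]]. now apply HU.
    + intro Ax. destruct (H x Ax) as [U [HU [Ux HA]]]. now exists U.
  - apply open_union. now intros U [HU _].
Qed.

Lemma open_bounded_inter (A : nat -> X -> Prop) n :
  (forall i, i < n -> isOpen T (A i)) -> isOpen T (fun x => forall i, i < n -> A i x).
Proof.
  induction n as [| n IH]; intro H.
  - apply open_ext with (U := fun _ => True); [| apply open_full].
    intro x. split; [intros _ i Hi; lia | trivial].
  - apply open_ext with (U := fun x => (forall i, i < n -> A i x) /\ A n x).
    + intro x. split.
      * intros [H1 H2] i Hi. destruct (Nat.eq_dec i n) as [-> |]; [exact H2 |].
        apply H1. lia.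
      * intro H1. split; intros; apply H1; lia.
    + apply open_inter; [apply IH; intros; apply H; lia | apply H; lia].
Qed.

Lemma clopen_compl (C : X -> Prop) : clopen T C -> clopen T (fun x => ~ C x).
Proof.
  intros [HO HC]. split; [exact HC |].
  apply open_ext with (U := C); [| exact HO]. intro x. tauto.
Qed.

Lemma clopen_bounded_union (C : nat -> X -> Prop) n :
  (forall k, clopen T (C k)) -> clopen T (fun x => exists k, k <= n /\ C k x).
Proof.
  intro H. split.
  - apply open_indexed_union. intros k _. apply H.
  - apply open_ext with (U := fun x => forall k, k < S n -> ~ C k x).
    + intro x. split.
      * intros H1 [k [Hk Hx]]. apply (H1 k); [lia | exact Hx].
      * intros H1 k Hk Hx. apply H1. exists k. split; [lia | exact Hx].
    + apply open_bounded_inter. intros k _. apply H.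
Qed.

(** * Continuity into the product and least indices *)

Lemma continuous_nbarN_coordinates (Psi : X -> nat -> nbar) :
  (forall n V, nbar_open V -> isOpen T (fun x => V (Psi x n))) ->
  continuous_nbarN T Psi.
Proof.
  intros H U HU. apply open_locally. intros x Ux.
  destruct (HU _ Ux) as [n [V [HV [Vx VU]]]].
  exists (fun y => forall i, i < n -> V i (Psi y i)). split; [| split].
  - apply open_bounded_inter with (A := fun i y => V i (Psi y i)).
    intros i Hi. apply H. now apply HV.
  - exact Vx.
  - intros y Hy. now apply VU.
Qed.

Lemma continuous_nbarN_coordinate (Psi : X -> nat -> nbar) n V :
  continuous_nbarN T Psi -> nbar_open V -> isOpen T (fun x => V (Psi x n)).
Proof.
  intros H HV. apply (H (fun f => V (f n))). intros f Hf.
  (* The guard [i = n] leaves every other coordinate unrestricted. *)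
  exists (S n), (fun i o => i = n -> V o). split; [| split].
  - intros i _ HN. destruct (Nat.eq_dec i n) as [Hi | Hi].
    + destruct (HV (HN Hi)) as [m Hm]. exists m. intros k Hk _. now apply Hm.
    + exists 0. intros k _ E. contradiction.
  - now intros i _ ->.
  - intros g Hg. apply (Hg n); lia.
Qed.

Definition is_least_index (C : nat -> X -> Prop) (x : X) (o : nbar) : Prop :=
  match o with
  | None => forall k, ~ C k x
  | Some k => C k x /\ forall j, j < k -> ~ C j x
  end.

Lemma least_index_exists (C : nat -> X -> Prop) (x : X) :
  exists o, is_least_index C x o.
Proof.
  destruct (classic (exists k, C k x)) as [[k Hk] | H].
  - induction k as [k IH] using lt_wf_ind.
    destruct (classic (exists j, j < k /\ C j x)) as [[j [Hj Cj]] | Hmin].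
    + now apply (IH j).
    + exists (Some k). split; [exact Hk |]. intros j Hj Cj. apply Hmin. now exists j.
  - exists None. intros k Hk. apply H. now exists k.
Qed.

(** Near a point of finite value [k], the value is constant on [C k] minus the earlier sets. Near a
    point of value infinity, avoiding the first [m] sets forces all values to be infinite or at
    least [m], which suffices as [V] contains a tail. *)
Lemma least_index_open (C : nat -> X -> Prop) (phi : X -> nbar) (V : nbar -> Prop) :
  (forall k, clopen T (C k)) -> (forall x, is_least_index C x (phi x)) ->
  nbar_open V -> isOpen T (fun x => V (phi x)).
Proof.
  intros HC Hphi HV. apply open_locally. intros x Vx.
  assert (Hbelow : forall m, isOpen T (fun y => forall j, j < m -> ~ C j y)).
  { intro m. apply open_bounded_inter. intros j _. apply HC. }
  pose proof (Hphi x) as Hx. destruct (phi x) as [k |].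
  - exists (fun y => C k y /\ forall j, j < k -> ~ C j y). split; [| split].
    + apply open_inter; [apply HC | apply Hbelow].
    + exact Hx.
    + intros y [Cy Hy]. pose proof (Hphi y) as H. destruct (phi y) as [l |].
      * destruct H as [Cl Hl]. replace l with k; [exact Vx |].
        destruct (Nat.lt_trichotomy k l) as [E | [E | E]]; [| exact E |].
        -- now apply Hl in E.
        -- now apply Hy in E.
      * now apply H in Cy.
  - destruct (HV Vx) as [m Hm].
    exists (fun y => forall j, j < m -> ~ C j y). split; [| split].
    + apply Hbelow.
    + intros j _. apply Hx.
    + intros y Hy. pose proof (Hphi y) as H. destruct (phi y) as [l |]; [| exact Vx].
      apply Hm. destruct (Nat.le_gt_cases m l) as [E | E]; [exact E |].
      destruct (Hy l E). apply H.
Qed.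

(** * F_sigma sets *)

Definition F_sigma (A : X -> Prop) : Prop :=
  exists F : nat -> X -> Prop,
    (forall n, isOpen T (fun x => ~ F n x)) /\ (forall x, A x <-> exists n, F n x).

Lemma F_sigma_ext (A B : X -> Prop) :
  (forall x, A x <-> B x) -> F_sigma A -> F_sigma B.
Proof.
  intros H [F [HF HA]]. exists F. split; [exact HF |].
  intro x. now rewrite <- H.
Qed.

Lemma F_sigma_countable_union (A : nat -> X -> Prop) :
  (forall n, F_sigma (A n)) -> F_sigma (fun x => exists n, A n x).
Proof.
  intro H. destruct (functional_choice _ H) as [F HF].
  exists (fun p => F (fst (of_nat p)) (snd (of_nat p))). split.
  - intro p. apply HF.
  - intro x. split.
    + intros [n Hn]. apply HF in Hn. destruct Hn as [k Hk].
      exists (to_nat (n, k)). now rewrite cancel_of_to.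
    + intros [p Hp]. exists (fst (of_nat p)). apply HF. eauto.
Qed.

(** * Borel sets and Borel maps *)

Lemma borel_inter (A B : X -> Prop) :
  borel T A -> borel T B -> borel T (fun x => A x /\ B x).
Proof.
  intros HA HB.
  apply borel_ext with
    (A := fun x => ~ exists n, match n with 0 => ~ A x | S _ => ~ B x end).
  - intro x. split.
    + intro H. split; apply NNPP; intro N; apply H; [now exists 0 | now exists 1].
    + intros [Ax Bx] [[| n] Hn]; contradiction.
  - apply borel_compl.
    apply borel_cunion with (A := fun n x => match n with 0 => ~ A x | S _ => ~ B x end).
    intros [| n]; now apply borel_compl.
Qed.

(** Induction on [n]: split by the value [m] of the last coordinate and freeze that coordinate at
    [m]. What remains depends on one coordinate fewer, and there are countably many [m]. *)
Lemma borel_finite_dependence (Psi : X -> nat -> nat) (n : nat) :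
  (forall i m, borel T (fun x => Psi x i = m)) ->
  forall P : (nat -> nat) -> Prop,
    (forall f g, (forall i, i < n -> f i = g i) -> P f -> P g) ->
    borel T (fun x => P (Psi x)).
Proof.
  intro HPsi. induction n as [| n IH]; intros P HP.
  - apply borel_ext with (A := fun _ => P (fun _ => 0)).
    + intro x. split; apply HP; lia.
    + apply borel_open, open_const.
  - apply borel_ext with
      (A := fun x => exists m, Psi x n = m /\
              P (fun i => if Nat.eq_dec i n then m else Psi x i)).
    + intro x. split.
      * intros [m [Hm H]]. revert H. apply HP. intros i _.
        now destruct (Nat.eq_dec i n) as [-> |].
      * intro H. exists (Psi x n). split; [reflexivity |].
        revert H. apply HP. intros i _. now destruct (Nat.eq_dec i n) as [-> |].
    + apply borel_cunion with
        (A := fun m x => Psi x n = m /\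
                P (fun i => if Nat.eq_dec i n then m else Psi x i)).
      intro m. apply borel_inter; [apply HPsi |].
      apply (IH (fun f => P (fun i => if Nat.eq_dec i n then m else f i))).
      intros f g Hfg. apply HP. intros i Hi.
      destruct (Nat.eq_dec i n); [reflexivity | apply Hfg; lia].
Qed.

(** An open [U] is the union over [n] of the sets of sequences whose cylinder of length [n] lies in
    [U], and each of these depends on [n] coordinates only. *)
Lemma borel_fun_coordinates (Psi : X -> nat -> nat) :
  (forall i m, borel T (fun x => Psi x i = m)) -> borel_fun T Psi.
Proof.
  intros HPsi U HU.
  apply borel_ext with
    (A := fun x => exists n, forall g, (forall i, i < n -> Psi x i = g i) -> U g).
  - intro x. split.
    + intros [n H]. now apply H.
    + intro Ux. destruct (HU _ Ux) as [n [V [_ [Vx VU]]]].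
      exists n. intros g Hg. apply VU. intros i Hi. rewrite <- Hg by exact Hi.
      now apply Vx.
  - apply borel_cunion with
      (A := fun n x => forall g, (forall i, i < n -> Psi x i = g i) -> U g).
    intro n.
    apply borel_finite_dependence with (n := n)
      (P := fun f => forall g, (forall i, i < n -> f i = g i) -> U g);
      [exact HPsi |].
    intros f f' Hf H g Hg. apply H. intros i Hi. rewrite Hf by exact Hi. now apply Hg.
Qed.

Lemma borel_fun_coordinate (Psi : X -> nat -> nat) n m :
  borel_fun T Psi -> borel T (fun x => Psi x n = m).
Proof.
  intro H. apply (H (fun f => f n = m)). intros f Hf.
  exists (S n), (fun i k => k = f i). split; [| split].
  - easy.
  - reflexivity.
  - intros g Hg. now rewrite Hg by lia.
Qed.

(** * From Borel maps to continuous maps *)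

Lemma continuous_nbarN_bounded_of_borel :
  (forall Psi : X -> nat -> nat, borel_fun T Psi -> bounded_N (image Psi)) ->
  forall Psi : X -> nat -> nbar, continuous_nbarN T Psi -> bounded_nbar (image Psi).
Proof.
  intros H Psi HPsi.
  pose (Phi := fun x n => match Psi x n with Some k => k | None => 0 end).
  destruct (H Phi) as [g Hg].
  - apply borel_fun_coordinates. intros n [| m].
    (* The value 0 also comes from infinity, so its preimage is the complement of the open set of
       positive finite values. *)
    + apply borel_ext with (A := fun x => ~ exists k, Psi x n = Some (S k)).
      * intro x. unfold Phi. destruct (Psi x n) as [[| k] |]; split; try easy.
        -- now intros _ [k Hk].
        -- intro N. destruct N. now exists k.
        -- now intros _ [k Hk].
      * apply borel_compl, borel_open.
        apply (continuous_nbarN_coordinate Psi n (fun o => exists k, o = Some (S k)) HPsi).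
        now intros [k Hk].
    + apply borel_ext with (A := fun x => Psi x n = Some (S m)).
      * intro x. unfold Phi. destruct (Psi x n) as [k |]; split; congruence.
      * apply borel_open.
        now apply (continuous_nbarN_coordinate Psi n (fun o => o = Some (S m)) HPsi).
  - exists g. intros f [x <-].
    destruct (Hg (Phi x) (ex_intro _ x eq_refl)) as [N HN].
    exists N. intros n Hn k Hk. specialize (HN n Hn). unfold Phi in HN.
    now rewrite Hk in HN.
Qed.

(** * From continuous maps to Borel maps *)

Hypothesis bounded : forall Psi : X -> nat -> nbar,
  continuous_nbarN T Psi -> bounded_nbar (image Psi).

Lemma clopen_least_index_bounded (C : nat -> nat -> X -> Prop) :
  (forall n k, clopen T (C n k)) ->
  exists g : nat -> nat, forall x, exists N, forall n, N <= n ->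
    (exists k, C n k x) -> exists k, k <= g n /\ C n k x.
Proof.
  intro HC.
  destruct (functional_choice (fun (p : X * nat) o => is_least_index (C (snd p)) (fst p) o))
    as [phi Hphi].
  { intros [x n]. apply least_index_exists. }
  destruct (bounded (fun x n => phi (x, n))) as [g Hg].
  { apply continuous_nbarN_coordinates. intros n V HV.
    apply least_index_open with (C := C n); [apply HC | | exact HV].
    intro x. apply (Hphi (x, n)). }
  exists g. intro x. destruct (Hg _ (ex_intro _ x eq_refl)) as [N HN].
  exists N. intros n Hn [k Hk]. specialize (HN n Hn).
  pose proof (Hphi (x, n)) as H. simpl in *.
  destruct (phi (x, n)) as [l |].
  - exists l. split; [now apply HN | apply H].
  - now apply H in Hk.
Qed.

Hypothesis hX : open_countable_union_clopen T.

(** [D n] is the union of the clopen pieces of [U n] with index at most [g n], where [g] bounds the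
    least indices. *)
Lemma open_clopen_approximation (U : nat -> X -> Prop) :
  (forall n, isOpen T (U n)) ->
  exists D : nat -> X -> Prop,
    (forall n, clopen T (D n)) /\ (forall n x, D n x -> U n x) /\
    (forall x, exists N, forall n, N <= n -> U n x -> D n x).
Proof.
  intro HU. destruct (functional_choice _ (fun n => hX (U n) (HU n))) as [C HC].
  destruct (clopen_least_index_bounded C) as [g Hg]; [intro n; apply HC |].
  exists (fun n x => exists k, k <= g n /\ C n k x). split; [| split].
  - intro n. apply clopen_bounded_union. apply HC.
  - intros n x [k [_ Hk]]. apply HC. now exists k.
  - intro x. destruct (Hg x) as [N HN]. exists N. intros n Hn Ux.
    apply HN; [exact Hn |]. now apply HC.
Qed.

(* Each [U n] is repeated infinitely often in the sequence that is approximated,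
   so that a tail of [D] still lies in every [U n]. *)
Lemma G_delta_F_sigma (U : nat -> X -> Prop) :
  (forall n, isOpen T (U n)) -> F_sigma (fun x => forall n, U n x).
Proof.
  intro HU.
  destruct (open_clopen_approximation (fun p => U (fst (of_nat p))))
    as [D [HD [DU HN]]]; [intro p; apply HU |].
  exists (fun N x => forall p, N <= p -> D p x). split.
  - intro N.
    apply open_ext with (U := fun x => exists p, N <= p /\ ~ D p x).
    + intro x. split.
      * intros [p [Hp Hx]] H. now apply Hx, H.
      * intro H. apply NNPP. intro H'. apply H. intros p Hp.
        apply NNPP. intro Hx. apply H'. now exists p.
    + apply open_indexed_union with (A := fun p x => ~ D p x). intros p _. apply HD.
  - intro x. split.
    + intro Ux. destruct (HN x) as [N H]. exists N. intros p Hp. now apply H.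
    + intros [N H] n. pose proof (to_nat_non_decreasing n N) as Hle.
      specialize (H (to_nat (n, N)) ltac:(lia)). apply DU in H.
      now rewrite cancel_of_to in H.
Qed.

Lemma F_sigma_compl (A : X -> Prop) : F_sigma A -> F_sigma (fun x => ~ A x).
Proof.
  intros [F [HF HA]].
  apply F_sigma_ext with (A := fun x => forall n, ~ F n x).
  - intro x. rewrite HA. split.
    + intros H [n Hn]. now apply (H n).
    + intros H n Hn. apply H. now exists n.
  - now apply G_delta_F_sigma.
Qed.

Lemma borel_F_sigma (A : X -> Prop) : borel T A -> F_sigma A.
Proof.
  induction 1 as [U HU | A _ IH | A _ IH | A B HAB _ IH].
  (* Clopen sets are closed, so the given decomposition is already an F_sigma one. *)
  - destruct (hX U HU) as [C [HC HUC]].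
    exists C. split; [intro n; apply HC | exact HUC].
  - now apply F_sigma_compl.
  - now apply F_sigma_countable_union.
  - now apply F_sigma_ext with (A := A).
Qed.

Lemma borel_fun_bounded (Psi : X -> nat -> nat) :
  borel_fun T Psi -> bounded_N (image Psi).
Proof.
  intro HPsi.
  destruct (functional_choice (fun (p : nat * nat) F =>
      (forall j, isOpen T (fun x => ~ F j x)) /\
      (forall x, Psi x (fst p) = snd p <-> exists j : nat, F j x))) as [F HF].
  { intros [n m]. apply borel_F_sigma. now apply borel_fun_coordinate. }
  (* The index [k] codes a value of [Psi x n] and one closed piece of its preimage. A code is at
     least its first entry, so [k] bounds the value. *)
  pose (K := fun n k => F (n, fst (of_nat k)) (snd (of_nat k))).
  assert (HK : forall n k x, K n k x -> Psi x n <= k).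
  { intros n k x Hx. assert (E : Psi x n = fst (of_nat k)).
    { apply (HF (n, fst (of_nat k))). now exists (snd (of_nat k)). }
    rewrite E, <- (cancel_to_of k) at 1. rewrite cancel_of_to.
    pose proof (to_nat_non_decreasing (fst (of_nat k)) (snd (of_nat k))) as Hle.
    rewrite <- surjective_pairing, cancel_to_of in Hle. lia. }
  (* Approximating the complements of the closed sets from inside makes the complements of [D]
     clopen sets around the [K n k]. *)
  destruct (open_clopen_approximation
              (fun p x => ~ K (fst (of_nat p)) (snd (of_nat p)) x))
    as [D [HD [DK HN]]]; [intro p; apply HF |].
  destruct (clopen_least_index_bounded (fun n k x => ~ D (to_nat (n, k)) x)) as [h Hh].
  { intros n k. apply clopen_compl, HD. }
  exists h. intros f [x <-].
  destruct (HN x) as [N1 H1], (Hh x) as [N2 H2].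
  exists (N1 + N2). intros n Hn.
  destruct (H2 n ltac:(lia)) as [k [Hk Dk]].
  - destruct (proj1 (proj2 (HF (n, Psi x n)) x) eq_refl) as [j Hj].
    exists (to_nat (Psi x n, j)). intro HDx. apply DK in HDx. apply HDx.
    unfold K. rewrite cancel_of_to. cbn [fst snd]. now rewrite cancel_of_to.
  (* The code of [(n, k)] is at least [n], hence at least [N1] whatever [k] is. There the clopen set
     agrees with [K n k] at [x]. *)
  - pose proof (to_nat_non_decreasing n k) as Hle.
    specialize (H1 (to_nat (n, k)) ltac:(lia)). rewrite cancel_of_to in H1.
    enough (Psi x n <= k) by lia.
    apply HK. apply NNPP. intro HKx. now apply Dk, H1.
Qed.

End Topology.

Theorem mainTheorem17 (X : Type) (T : Topology X)
  (hX : open_countable_union_clopen T) :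
  (forall Psi : X -> nat -> nat, borel_fun T Psi -> bounded_N (image Psi)) <->
  (forall Psi : X -> nat -> nbar, continuous_nbarN T Psi -> bounded_nbar (image Psi)).
Proof.
  split.
  - apply continuous_nbarN_bounded_of_borel.
  - intros H Psi. now apply borel_fun_bounded.
Qed.
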